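(* Let $k\ge 3$ and let $L_1,\dots,L_k$ be nontrivial finite transitive permutation groups. The following are equivalent: (1) one of $L_1,\dots,L_k$ is not regular; (2) for every integer $c$, there exists a rank $k$ faithful amalgam of permutation type $[L_1,\dots,L_k]$ whose Borel subgroup has order at least $c$.
   Context: For $k\ge 2$, a rank $k$ amalgam is a finite set $\mathcal A$ with $k$ subsets $P_1,\dots,P_k$, each of which is a group, such that $\bigcup_i P_i=\mathcal A$, $\bigcap_i P_i\neq\emptyset$, and for all $i,j$ the group operations of $P_i$ and $P_j$ agree on $P_i\cap P_j$. Its Borel subgroup is $\mathcal B(\mathcal A)=\bigcap_i P_i$. $\mathcal A$ is faithful if no nontrivial subgroup of $\mathcal B(\mathcal A)$ is normalised by every $P_i$. Its permutation type is the multiset $[L_1,\dots,L_k]$ where $L_i$ is the permutation group induced by $P_i$ acting on the right cosets of $\mathcal B(\mathcal A)$ in $P_i$ (up to permutation isomorphism). *)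

(* Defs.v *)
From HB Require Import structures.
From mathcomp Require Import all_boot all_order all_algebra all_fingroup.

Set Implicit Arguments.
Unset Strict Implicit.
Unset Printing Implicit Defensive.

Local Open Scope group_scope.

(* The subset P_i of the finite set A, which carries its own group law, is given
   as a finite group together with an injection [incl i] into A; as a subset it
   is [part A i] below. *)
Record amalgam (k : nat) := Amalgam {
  carrier : finType;
  grp : 'I_k -> finGroupType;
  incl : forall i : 'I_k, grp i -> carrier;
  incl_inj : forall i : 'I_k, injective (@incl i);
  incl_cover : forall a : carrier,
    exists (i : 'I_k) (x : grp i), incl x = a;
  incl_meet : exists a : carrier,
    forall i : 'I_k, exists x : grp i, incl x = a;
  incl_agree : forall (i j : 'I_k) (x y : grp i) (x' y' : grp j),
    incl x = incl x' -> incl y = incl y' -> incl (x * y) = incl (x' * y')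
}.

Arguments incl {k} A i x : rename.

Definition part (k : nat) (A : amalgam k) (i : 'I_k) : {set carrier A} :=
  incl A i @: [set: grp A i].

Definition borel (k : nat) (A : amalgam k) : {set carrier A} :=
  \bigcap_(i < k) part A i.

Definition in_grp (k : nat) (A : amalgam k) (i : 'I_k) (H : {set carrier A}) :
    {set grp A i} :=
  incl A i @^-1: H.

Definition faithful_amalgam (k : nat) (A : amalgam k) : Prop :=
  forall H : {set carrier A},
    H \subset borel A ->
    (forall i : 'I_k, group_set (in_grp i H)) ->
    (forall i : 'I_k, [set: grp A i] \subset 'N(in_grp i H)) ->
    #|H| = 1%N.

Lemma borel_in_group_set (k : nat) (A : amalgam k) (i : 'I_k) :
  group_set (in_grp i (borel A)).
Proof.
have inB a : a \in borel A <-> forall j, exists x, incl A j x = a.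
  split=> [/bigcapP aB j|aB].
    by have /imsetP[x _ ->] := aB j isT; exists x.
  by apply/bigcapP=> j _; have [x <-] := aB j; apply/imsetP; exists x.
have BM x y : x \in in_grp i (borel A) -> y \in in_grp i (borel A) ->
    x * y \in in_grp i (borel A).
  rewrite !inE => /inB Bx /inB By; apply/inB => j.
  have [[x' Ex] [y' Ey]] := (Bx j, By j).
  by exists (x' * y'); apply: incl_agree.
apply/group_setP; split; last exact: BM.
have [a aP] := incl_meet A; have [x Ex] := aP i.
have Bx : x \in in_grp i (borel A) by rewrite inE Ex; apply/inB.
have BX n : x ^+ n.+1 \in in_grp i (borel A).
  by elim: n => // n IHn; rewrite expgS BM.
by rewrite -(expg_order x) -(prednK (order_gt0 x)) BX.
Qed.

Definition borel_in (k : nat) (A : amalgam k) (i : 'I_k) : {group grp A i} :=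
  group (borel_in_group_set A i).

Definition rcoset_type (gT : finGroupType) (B : {group gT}) : finType :=
  {X : {set gT} | X \in rcosets B [set: gT]}.

(* ['Rs] is right translation of subsets, and [^?] restricts it to the right
   cosets; [coset_act_dom] shows that the restriction is defined on all of gT. *)
Definition coset_perm_group (gT : finGroupType) (B : {group gT}) :
    {group {perm rcoset_type B}} :=
  (actperm ('Rs^? : action _ (rcoset_type B)) @* [set: gT])%G.

Lemma coset_act_dom (gT : finGroupType) (B : {group gT}) :
  [set: gT] \subset subact_dom (fun X => X \in rcosets B [set: gT]) 'Rs.
Proof.
apply/subsetP=> g _; rewrite !inE /=; apply/subsetP=> X.
rewrite !inE => /rcosetsP[x _ ->]; apply/rcosetsP.
by exists (x * g); rewrite ?inE //= rcosetE rcosetM.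
Qed.

Definition perm_isomorphic (S T : finType)
    (G : {group {perm S}}) (H : {group {perm T}}) : Prop :=
  exists2 f : S -> T, bijective f &
  exists2 phi : {morphism G >-> {perm T}}, isom G H phi &
    forall (x : S) (g : {perm S}), g \in G -> f (g x) = phi g (f x).

(* The bijection s of the indices expresses that types are multisets. *)
Definition has_permutation_type (k : nat) (A : amalgam k)
    (Omega : 'I_k -> finType) (L : forall i : 'I_k, {group {perm Omega i}}) :
    Prop :=
  exists s : {perm 'I_k}, forall i : 'I_k,
    perm_isomorphic (coset_perm_group (borel_in A i)) (L (s i)).

Definition transitive_group (T : finType) (L : {group {perm T}}) : Prop :=
  [transitive L, on [set: T] | 'P].

Definition regular_group (T : finType) (L : {group {perm T}}) : Prop :=
  transitive_group L /\ forall x : T, 'C_L[x | 'P] = 1.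

(* Main.v *)
(* If every L_i is regular, the Borel subgroup B acts trivially on its cosets
   in each P_i, so it is normal in every P_i and faithfulness makes it trivial.

   Conversely let L_i0 have a nontrivial point stabiliser S, let a, b be two
   further indices and S_j the point stabilisers in L_j.  Suppose that a finite
   set X carries permutations by L_a x S_b and by S_a x L_b which agree on
   S_a x S_b, are jointly transitive, and for which S_a x S_b fixes a point x0.
   Inside the product of a wreath product with base group L_i0^X and of all the
   L_j, let B be the semidirect product of S^X by prod_(j <> i0) S_j.  For
   i <> i0 let P_i enlarge the factor S_i of B to L_i, and let P_i0 enlarge the
   x0-coordinate of S^X to L_i0.  A subgroup of B normal in every P_i has
   trivial image in every L_j (the core of a point stabiliser is trivial), hence
   lies in S^X, and it vanishes at x0 for the same reason; by joint transitivity
   it vanishes on X.  As |S^X| is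
   unbounded, it remains to find X of arbitrarily large size: take m + 1 copies
   of Omega_a x Omega_b, and conjugate the action of L_b by the permutation that
   moves the base point of each copy to the next copy and fixes the rest. *)

Require Import Defs.
From HB Require Import structures.
From mathcomp Require Import all_boot all_order all_algebra all_fingroup.

Set Implicit Arguments.
Unset Strict Implicit.
Unset Printing Implicit Defensive.

Local Open Scope group_scope.

(** * Permutation isomorphisms from equivariant bijections *)

Section PermIsomorphism.

Variables (S T : finType) (G : {group {perm S}}) (H : {group {perm T}}).

(** Conjugation by [f] is the only candidate for the group isomorphism, so matching the elements of
    [G] and [H] along [f] is enough. *)
Lemma perm_isomorphic_equivariant (f : S -> T) :
    bijective f ->
    (forall g, g \in G -> exists2 h, h \in H & forall x, f (g x) = h (f x)) ->
    (forall h, h \in H -> exists2 g, g \in G & forall x, f (g x) = h (f x)) ->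
  perm_isomorphic G H.
Proof.
move=> bij_f GH HG; have [f' fK f'K] := bij_f.
have inj_conj (s : {perm S}) : injective (f \o s \o f').
  by apply: inj_comp (can_inj f'K); apply: inj_comp perm_inj; apply: can_inj fK.
pose phi s := perm (inj_conj s).
have phiE s x : phi s (f x) = f (s x) by rewrite permE /= fK.
have phi_uniq (s : {perm S}) (h : {perm T}) :
    (forall x, f (s x) = h (f x)) -> phi s = h.
  by move=> sh; apply/permP=> y; rewrite -(f'K y) phiE sh.
have phiM : {in G &, {morph phi : s t / s * t}}.
  by move=> s t _ _; apply: phi_uniq => x; rewrite !permM !phiE.
exists f => //; exists (Morphism phiM) => [|x g _]; last by rewrite /= phiE.
apply/isomP; split.
  apply/injmP=> s t _ _ /= Est; apply/permP=> x.
  by apply: (can_inj fK); rewrite -!phiE Est.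
apply/setP=> h; apply/morphimP/idP=> [[g _ Gg ->]|Hh] /=.
  by have [h' Hh' /phi_uniq ->] := GH g Gg.
by have [g Gg gh] := HG h Hh; exists g => //=; rewrite (phi_uniq _ _ gh).
Qed.

End PermIsomorphism.

(** * The permutation group induced on right cosets *)

Section CosetAction.

Variables (gT : finGroupType) (B : {group gT}).

Lemma coset_permE (g : gT) (X : rcoset_type B) :
  val (actperm ('Rs^? : action _ (rcoset_type B)) g X) = val X :* g.
Proof.
rewrite actpermE /= val_subact /= (subsetP (coset_act_dom B)) ?inE //.
by rewrite rcosetE.
Qed.

Lemma mem_coset_perm_group (g : gT) :
  actperm ('Rs^? : action _ (rcoset_type B)) g \in coset_perm_group B.
Proof.
have Tg := in_setT g.
exact: mem_morphim (subsetP (coset_act_dom B) g Tg) Tg.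
Qed.

(** Orbit-stabiliser: as [B] is the stabiliser of [w], the coset [B :* g] corresponds to the point
    [pi g w]. *)
Lemma coset_perm_group_isomorphic (T : finType) (L : {group {perm T}})
    (pi : gT -> {perm T}) (w : T) :
    transitive_group L -> {morph pi : x y / x * y} ->
    pi @: [set: gT] = L -> (forall g, (g \in B) = (pi g w == w)) ->
  perm_isomorphic (coset_perm_group B) L.
Proof.
move=> trL piM im_pi BE.
have piV g : pi g^-1 = (pi g)^-1.
  by apply: (mulgI (pi g)); rewrite -piM !mulgV; apply: (mulgI (pi 1));
     rewrite -piM !mulg1.
have Lpi g : pi g \in L by rewrite -im_pi imset_f ?inE.
have piB (X : rcoset_type B) g : g \in val X -> val X = B :* g.
  by have /rcosetsP[y _ ->] := valP X; move/rcoset_eqP=> ->.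
pose f (X : rcoset_type B) := pi (repr (val X)) w.
have fE (X : rcoset_type B) g : g \in val X -> f X = pi g w.
  move=> Xg; have: repr (val X) \in val X by apply: mem_repr Xg.
  rewrite {2}(piB X g Xg) mem_rcoset BE piM piV permM => /eqP E.
  by rewrite /f -{2}E permKV.
have Xr (X : rcoset_type B) : repr (val X) \in val X.
  by have /rcosetsP[y _ ->] := valP X; apply: mem_repr (rcoset_refl _ _).
have coset_of g : B :* g \in rcosets B [set: gT].
  by apply/rcosetsP; exists g; rewrite ?inE.
have inj_f : injective f.
  move=> X Y; rewrite {1}/f {1}/f => E; apply: val_inj.
  rewrite (piB X _ (Xr X)) (piB Y _ (Xr Y)); apply/rcoset_eqP.
  by rewrite mem_rcoset BE piM piV permM E permK.
have surj_f y : exists X, f X = y.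
  have: y \in orbit 'P L w by rewrite (atransP trL) ?inE.
  case/orbitP=> l; rewrite -im_pi => /imsetP[g _ ->] <-.
  by exists (Sub (B :* g) (coset_of g)); apply: fE; apply: rcoset_refl.
have f_eq X g : f (actperm ('Rs^? : action _ (rcoset_type B)) g X) = pi g (f X).
  rewrite (fE _ (repr (val X) * g)) ?piM ?permM //.
  by rewrite coset_permE mem_rcoset mulgK.
apply: (@perm_isomorphic_equivariant _ _ _ _ f).
- have [f' f'K] := fin_all_exists surj_f.
  by exists f' => // X; apply: inj_f; rewrite f'K.
- by move=> _ /morphimP[g _ _ ->]; exists (pi g) => // X; apply: f_eq.
move=> l; rewrite -im_pi => /imsetP[g _ ->].
exists (actperm ('Rs^? : action _ (rcoset_type B)) g) => [|X].
  exact: mem_coset_perm_group.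
exact: f_eq.
Qed.

(** An element of [B] fixes the point [B] of the coset space, so by regularity it acts trivially.
    That it also fixes the coset of [g^-1] says that its conjugate by [g] lies in [B]. *)
Lemma coset_perm_group_regular (T : finType) (L : {group {perm T}}) :
  regular_group L -> perm_isomorphic (coset_perm_group B) L -> B <| [set: gT].
Proof.
case=> _ regL [f bij_f [phi /isomP[/injmP inj_phi im_phi] phiE]].
pose act := actperm ('Rs^? : action _ (rcoset_type B)).
have Gact g : act g \in coset_perm_group B by apply: mem_coset_perm_group.
have coset_of g : B :* g \in rcosets B [set: gT].
  by apply/rcosetsP; exists g; rewrite ?inE.
have act1 b : b \in B -> act b = 1.
  move=> Bb; apply: inj_phi; rewrite ?group1 // morph1.
  pose X : rcoset_type B := Sub (B :* 1) (coset_of 1).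
  have actX : act b X = X.
    by apply: val_inj; rewrite coset_permE /= mulg1 rcoset_id.
  suff: phi (act b) \in 'C_L[f X | 'P] by rewrite regL => /set1P.
  rewrite inE -im_phi mem_morphim //=; apply/astab1P; rewrite /= /aperm.
  by rewrite -phiE ?actX.
apply/normalP; split=> [|g _]; first exact: subsetT.
apply/eqP; rewrite eqEcard cardJg leqnn andbT.
apply/subsetP=> _ /imsetP[b Bb ->].
pose X : rcoset_type B := Sub (B :* g^-1) (coset_of g^-1).
have /(congr1 val) := congr1 (fun s : {perm _} => s X) (act1 b Bb).
rewrite perm1 coset_permE /= -rcosetM => E.
have := rcoset_refl B (g^-1 * b); rewrite E mem_rcoset invgK.
by rewrite /conjg mulgA.
Qed.

End CosetAction.

(** * Amalgams formed by subgroups of a finite group *)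

Section SubgroupAmalgam.

Variables (gT : finGroupType) (k : nat) (P : 'I_k -> {group gT}) (i0 : 'I_k).

Definition union_type : finType := {x : gT | x \in \bigcup_(i < k) P i}.

Fact union_incl_subproof (i : 'I_k) (u : subg_of (P i)) :
  sgval u \in \bigcup_(i < k) P i.
Proof. by apply/bigcupP; exists i => //; apply: subgP. Qed.

Definition union_incl (i : 'I_k) (u : subg_of (P i)) : union_type :=
  Sub (sgval u) (union_incl_subproof u).

Fact union_incl_inj (i : 'I_k) : injective (@union_incl i).
Proof. by move=> u v /(congr1 val) /subg_inj. Qed.

Lemma union_inclP (i : 'I_k) (a : union_type) :
  reflect (exists u, @union_incl i u = a) (val a \in P i).
Proof.
apply: (iffP idP) => [Pa|[u <-]]; last exact: subgP.
by exists (Subg Pa); apply: val_inj.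
Qed.

Fact union_incl_cover (a : union_type) : exists i u, @union_incl i u = a.
Proof.
by have /bigcupP[i _ /union_inclP[u ua]] := valP a; exists i, u.
Qed.

Fact union_incl_meet : exists a, forall i, exists u, @union_incl i u = a.
Proof.
exists (@union_incl i0 1) => i; apply/union_inclP; exact: group1.
Qed.

Fact union_incl_agree (i j : 'I_k)
    (x y : subg_of (P i)) (x' y' : subg_of (P j)) :
  union_incl x = union_incl x' -> union_incl y = union_incl y' ->
  union_incl (x * y) = union_incl (x' * y').
Proof.
move=> /(congr1 val) /= Ex /(congr1 val) /= Ey.
by apply: val_inj; rewrite /= Ex Ey.
Qed.

Definition subgroup_amalgam : amalgam k :=
  Amalgam union_incl_inj union_incl_cover union_incl_meet union_incl_agree.

Lemma mem_borel_subgroup_amalgam (a : union_type) :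
  (a \in borel subgroup_amalgam) = (val a \in \bigcap_(i < k) P i).
Proof.
apply/bigcapP/bigcapP=> Pa i _.
  by have /imsetP[u _ ->] := Pa i isT; apply: subgP.
by have /union_inclP[u <-] := Pa i isT; apply: imset_f; rewrite inE.
Qed.

Lemma card_borel_subgroup_amalgam :
  #|borel subgroup_amalgam| = #|\bigcap_(i < k) P i|.
Proof.
rewrite -(card_imset _ val_inj); apply: eq_card => x.
apply/imsetP/idP=> [[a Ba ->]|Bx]; first by rewrite -mem_borel_subgroup_amalgam.
have Ux : x \in \bigcup_(i < k) P i.
  by apply/bigcupP; exists i0 => //; apply: (bigcapP Bx).
by exists (Sub x Ux); rewrite ?mem_borel_subgroup_amalgam.
Qed.

(** A subset of the Borel subgroup lies in every [P i], so its group and normality properties carry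
    over to its image in [gT]. *)
Lemma faithful_subgroup_amalgam :
    (forall H : {group gT}, H \subset \bigcap_(i < k) P i ->
       (forall i, P i \subset 'N(H)) -> H :=: 1) ->
  faithful_amalgam subgroup_amalgam.
Proof.
move=> coreP H sHB gH nH; pose K := val @: H.
have Pval (a : union_type) i : a \in H -> val a \in P i.
  move/(subsetP sHB); rewrite mem_borel_subgroup_amalgam.
  by move/bigcapP; apply.
have HE i (u : subg_of (P i)) :
    (sgval u \in K) = (u \in in_grp (A := subgroup_amalgam) i H).
  rewrite inE; apply/imsetP/idP=> [[a Ha Ea]|Hu]; last by exists (union_incl u).
  by rewrite (_ : incl subgroup_amalgam i u = a) //; apply: val_inj.
have PK x i : x \in K -> x \in P i by case/imsetP=> a Ha ->; apply: Pval.
have gK : group_set K.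
  have /group_setP[H1 HM] := gH i0; apply/group_setP; split=> [|x y Kx Ky].
    by rewrite -[1]/(sgval (1 : subg_of (P i0))) HE.
  have [Px Py] := (PK _ i0 Kx, PK _ i0 Ky).
  rewrite -[_ * _]/(sgval (Subg Px * Subg Py)) HE.
  by apply: HM; rewrite -HE.
have K1 : K = 1.
  apply: (coreP (group gK)) => [|i]; apply/subsetP=> x.
    by move=> Kx; apply/bigcapP=> i _; apply: PK.
  move=> Px; rewrite inE; apply/subsetP=> _ /imsetP[y Ky ->].
  have Py := PK _ i Ky.
  rewrite -[_ ^ _]/(sgval (Subg Py ^ Subg Px)) HE.
  rewrite memJ_norm -?HE //; apply: (subsetP (nH i)); exact: in_setT.
by rewrite -(card_imset _ val_inj) -/K K1 cards1.
Qed.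

(** Multiplicativity is asked on [P i] only, because evaluating a base coordinate of a wreath
    product is multiplicative on elements fixing that point, but not in general. *)
Lemma subgroup_amalgam_perm_type (i : 'I_k) (T : finType) (L : {group {perm T}})
    (pi : gT -> {perm T}) (w : T) :
    transitive_group L -> {in P i &, {morph pi : x y / x * y}} ->
    pi @: P i = L ->
    {in P i, forall g, (g \in \bigcap_(j < k) P j) = (pi g w == w)} ->
  perm_isomorphic (coset_perm_group (borel_in subgroup_amalgam i)) L.
Proof.
move=> trL piM im_pi BE.
apply: (@coset_perm_group_isomorphic _ _ _ _ (fun u => pi (sgval u)) w) => //.
- by move=> u v; rewrite -piM ?subgP.
- rewrite -im_pi; apply/setP=> t; apply/imsetP/imsetP=> [[u _ ->]|[g Pg ->]].
    by exists (sgval u); rewrite ?subgP.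
  by exists (Subg Pg).
move=> u; rewrite -BE ?subgP //.
by rewrite -[RHS]/(val (union_incl u) \in _) -mem_borel_subgroup_amalgam inE.
Qed.

End SubgroupAmalgam.

(** * Wreath products *)

Section Wreath.

Variables (X : finType) (gT : finGroupType).

(** A type of its own, so that it carries the twisted group law and not the componentwise law of a
    direct product. *)
Definition wreath : Type := ({ffun X -> gT} * {perm X})%type.

HB.instance Definition _ := Finite.on wreath.

Definition wreath_base (u : wreath) : {ffun X -> gT} := u.1.
Definition wreath_top (u : wreath) : {perm X} := u.2.

(** The base of [v] is read at [u.2 x] because in a product of permutations the left factor acts
    first. *)
Definition wreath_mul (u v : wreath) : wreath :=
  ([ffun x => u.1 x * v.1 (u.2 x)], u.2 * v.2).
Definition wreath_one : wreath := ([ffun=> 1], 1).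
Definition wreath_inv (u : wreath) : wreath :=
  ([ffun x => (u.1 (u.2^-1 x))^-1], u.2^-1).

Fact wreath_mulA : associative wreath_mul.
Proof.
move=> u v w; congr (_, _); last exact: mulgA.
by apply/ffunP=> x; rewrite !ffunE permM mulgA.
Qed.

Fact wreath_mul1 : left_id wreath_one wreath_mul.
Proof.
case=> f p; congr (_, _); last exact: mul1g.
by apply/ffunP=> x; rewrite !ffunE perm1 mul1g.
Qed.

Fact wreath_mulV : left_inverse wreath_one wreath_inv wreath_mul.
Proof.
case=> f p; congr (_, _); last exact: mulVg.
by apply/ffunP=> x; rewrite !ffunE mulVg.
Qed.

HB.instance Definition _ :=
  Finite_isGroup.Build wreath wreath_mulA wreath_mul1 wreath_mulV.

Lemma wreath_baseM (u v : wreath) x : 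
  wreath_base (u * v) x = wreath_base u x * wreath_base v (wreath_top u x).
Proof. by rewrite ffunE. Qed.

End Wreath.

(** * Point stabilisers in transitive groups *)

Section TransitiveGroups.

Variables (T : finType) (L : {group {perm T}}).
Hypothesis trL : transitive_group L.

Lemma mem_perm_stab (w : T) (s : {perm T}) :
  (s \in 'C_L[w | 'P]) = (s \in L) && (s w == w).
Proof. by rewrite inE; congr (_ && _); apply/astab1P/eqP. Qed.

Lemma transitive_groupP (x y : T) : exists2 s, s \in L & s x = y.
Proof. by have [s Ls ->] := atransP2 trL (in_setT x) (in_setT y); exists s. Qed.

Lemma nontrivial_transitive_neq (w : T) : L :!=: 1 -> exists y, y != w.
Proof.
case/trivgPn=> s Ls s1; have /existsP[x sx] : [exists x, s x != x].
  apply: contraR s1; rewrite negb_exists => /forallP s1.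
  by apply/eqP/permP=> x; rewrite perm1; apply/eqP; rewrite -[_ == _]negbK.
have [->|] := eqVneq w x; last by exists x; rewrite eq_sym.
by exists (s x).
Qed.

(* The hypothesis holds for s in a normal subgroup contained in the stabiliser
   of w, with s' = s ^ t. *)
Lemma transitive_core1 (w : T) (s : {perm T}) :
    (forall t, t \in L -> exists2 s', s * t = t * s' & s' w = w) -> s = 1.
Proof.
move=> sL; apply/permP=> x; rewrite perm1.
have [t Lt txw] := transitive_groupP x w; have [s' st s'w] := sL t Lt.
by apply: (@perm_inj _ t); rewrite -permM st permM txw.
Qed.

(** Point stabilisers are conjugate, so if the one at [w] is trivial then all are. *)
Lemma nonregular_stab (w : T) : ~ regular_group L -> 'C_L[w | 'P] != 1.
Proof.
move=> nregL; apply/eqP=> Cw1; apply: nregL; split=> // x.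
apply/trivgP/subsetP=> s; rewrite mem_perm_stab => /andP[Ls /eqP sx].
have [t Lt tx] := transitive_groupP x w.
have: s ^ t \in 'C_L[w | 'P].
  by rewrite mem_perm_stab groupJ //= -{1}tx permJ sx tx.
by rewrite Cw1 !inE conjg_eq1.
Qed.

End TransitiveGroups.

(** * Pairs of permutations acting on copies of a product *)

Section PairPerm.

Variables (T U V : finType).

Fact pair_perm_subproof (s : {perm T}) (t : {perm U}) :
  injective (fun x : T * U * V => (s x.1.1, t x.1.2, x.2)).
Proof. by move=> [[x y] v] [[x' y'] v'] /= [/perm_inj-> /perm_inj-> ->]. Qed.

Definition pair_perm s t : {perm T * U * V} := perm (@pair_perm_subproof s t).

Lemma pair_permE s t x : pair_perm s t x = (s x.1.1, t x.1.2, x.2).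
Proof. by rewrite permE. Qed.

Lemma pair_permM s t s' t' :
  pair_perm (s * s') (t * t') = pair_perm s t * pair_perm s' t'.
Proof. by apply/permP=> x; rewrite permM !pair_permE !permM. Qed.

Lemma pair_perm1 : pair_perm 1 1 = 1.
Proof. by apply/permP=> -[[x y] v]; rewrite pair_permE !perm1. Qed.

End PairPerm.

(** * The overgroup, the groups P_i and their intersection *)

Section Construction.

Variables (k : nat) (Omega : 'I_k -> finType).
Variable L : forall i : 'I_k, {group {perm Omega i}}.
Hypothesis L_nontrivial : forall i, L i :!=: 1.
Hypothesis L_transitive : forall i, transitive_group (L i).
Variables (w : forall i, Omega i) (i0 a b : 'I_k) (m : nat).
Hypotheses (a_i0 : a != i0) (b_i0 : b != i0) (b_a : b != a).

Local Notation S i := ('C_(L i)[w i | 'P])%G.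
Local Notation X := (Omega a * Omega b * 'I_m.+1)%type.
Local Notation Ls := {dffun forall i, {perm Omega i}}.
Local Notation overgroup := (wreath X {perm Omega i0} * Ls)%type.

Local Notation base t := ((w a, w b, t) : X).

Fact shift_subproof :
  injective (fun x : X => if x.1 == (w a, w b) then (x.1, ordS x.2) else x).
Proof.
apply: (can_inj (g := fun x : X =>
  if x.1 == (w a, w b) then (x.1, ord_pred x.2) else x)) => -[p t] /=.
by case E: (p == _); rewrite /= E ?ordSK.
Qed.

Definition shift : {perm X} := perm shift_subproof.

Lemma shift_base t : shift (base t) = base (ordS t).
Proof. by rewrite permE /= eqxx. Qed.

Lemma shift_id (x : X) : x.1 != (w a, w b) -> shift x = x.
Proof. by rewrite permE /= => /negPf->. Qed.

(* The conjugation by shift is what links the copies of Omega a * Omega b. *)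
Definition twist (i : 'I_k) (l : Ls) : {perm X} :=
  pair_perm _ (l a) (l b) ^ (if i == b then shift else 1).

Lemma twist1 i : twist i 1 = 1.
Proof. by rewrite /twist !oneg_ffun pair_perm1 conj1g. Qed.

Lemma twistM i : {morph twist i : l l' / l * l'}.
Proof. by move=> l l'; rewrite /twist !mulg_ffun pair_permM conjMg. Qed.

(** A pair that fixes both base points commutes with [shift]. Hence the two actions on X agree on
    S_a x S_b. *)
Lemma twist_stab i (l : Ls) : l a (w a) = w a -> l b (w b) = w b ->
  twist i l = pair_perm _ (l a) (l b).
Proof.
move=> la lb; rewrite /twist; case: eqP => _; last by rewrite conjg1.
apply/conjg_fixP/commgP/permP=> -[[x y] t]; rewrite !permM pair_permE /=.
have [[-> ->]|nxy] := eqVneq (x, y) (w a, w b).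
  by rewrite la lb !shift_base pair_permE /= la lb.
rewrite !shift_id ?pair_permE //=.
apply: contra nxy => /eqP[Ex Ey]; apply/eqP; congr (_, _).
  by apply: (@perm_inj _ (l a)); rewrite la.
by apply: (@perm_inj _ (l b)); rewrite lb.
Qed.

(* The i0-component is kept trivial: in the factor P_i0 the role of L i0 is
   played by the coordinate of the base group at [base ord0]. *)
Definition local_grp (i j : 'I_k) : {group {perm Omega j}} :=
  if j == i0 then 1%G else if j == i then L j else S j.

Definition base_grp (i : 'I_k) (x : X) : {group {perm Omega i0}} :=
  if (i == i0) && (x == base ord0) then L i0 else S i0.

(** The family in [Ls] determines the permutation of X, but has to be recorded separately since
    [twist] depends only on its components at [a] and [b]. *)
Definition factor_set (i : 'I_k) : {set overgroup} :=
  [set g | [&& wreath_top g.1 == twist i g.2,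
               [forall j, g.2 j \in local_grp i j]
               & [forall x, wreath_base g.1 x \in base_grp i x]]].

Lemma factor_setP i (g : overgroup) :
  reflect [/\ wreath_top g.1 = twist i g.2, forall j, g.2 j \in local_grp i j
            & forall x, wreath_base g.1 x \in base_grp i x]
          (g \in factor_set i).
Proof.
rewrite inE.
by apply: (iffP and3P) => -[/eqP Eg lg fg]; split=> //; apply/forallP.
Qed.

Lemma local_grp_fix i j s : j != i -> s \in local_grp i j -> s (w j) = w j.
Proof.
rewrite /local_grp => /negPf->; case: ifP => _.
  by move/set1P->; rewrite perm1.
by rewrite mem_perm_stab => /andP[_ /eqP].
Qed.

(** Closure under products needs this, as the permutation part moves the base coordinates. Only [i0]
    has a distinguished coordinate, and there [l] fixes both base points. *)
Lemma base_grp_twist i (l : Ls) x :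
  (forall j, l j \in local_grp i j) -> base_grp i (twist i l x) = base_grp i x.
Proof.
move=> ll; rewrite /base_grp; case: eqP => //= Ei; rewrite Ei in ll *.
have [la lb] := (local_grp_fix a_i0 (ll a), local_grp_fix b_i0 (ll b)).
have <-: twist i0 l (base ord0) = base ord0.
  by rewrite twist_stab // pair_permE /= la lb.
by rewrite (inj_eq perm_inj) twist_stab // pair_permE /= la lb.
Qed.

Fact factor_group_set i : group_set (factor_set i).
Proof.
apply/group_setP; split=> [|g h].
  by apply/factor_setP; split=> [|j|x]; rewrite ?twist1 ?ffunE ?group1.
case/factor_setP=> Eg lg fg /factor_setP[Eh lh fh].
apply/factor_setP; split=> [|j|x].
- by rewrite twistM -Eg -Eh.
- by rewrite mulg_ffun; apply: groupM (lg j) (lh j).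
rewrite wreath_baseM; apply: groupM (fg x) _.
by rewrite -(base_grp_twist _ lg) -Eg.
Qed.

Definition factor i := group (factor_group_set i).

Definition borel_set : {set overgroup} := \bigcap_(i < k) factor i.

(** Two factors already cut out the intersection: [factor i0] restricts the components in [Ls], and
    [factor a] restricts the base. *)
Lemma borel_setP (g : overgroup) :
  reflect [/\ wreath_top g.1 = pair_perm _ (g.2 a) (g.2 b),
              forall j, g.2 j \in local_grp i0 j &
              forall x, wreath_base g.1 x \in S i0]
          (g \in borel_set).
Proof.
apply: (iffP bigcapP) => [Pg|[Eg lg fg] i _].
  have /factor_setP[Eg lg _] := Pg i0 isT.
  have /factor_setP[_ _ fg] := Pg a isT.
  split=> // [|x]; last by have := fg x; rewrite /base_grp (negPf a_i0).
  by rewrite Eg twist_stab ?(local_grp_fix _ (lg _)).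
apply/factor_setP; split=> [|j|x].
- by rewrite twist_stab ?(local_grp_fix _ (lg _)).
- have := lg j; rewrite /local_grp; case: (j == i0) => //.
  by case: (j == i) => //; rewrite mem_perm_stab => /andP[].
rewrite /base_grp; case: ifP => // _.
by have := fg x; rewrite mem_perm_stab => /andP[].
Qed.

Definition lift_local (i : 'I_k) (t : {perm Omega i}) : overgroup :=
  (([ffun=> 1], twist i (dfung1 t)) : wreath X {perm Omega i0}, dfung1 t : Ls).

Lemma lift_local_factor i t : i != i0 -> t \in L i -> lift_local t \in factor i.
Proof.
move=> i_i0 Lt; apply/factor_setP; split=> //= [j|x]; last first.
  by rewrite ffunE group1.
have [<-|ij] := eqVneq i j; last by rewrite dfung1_dflt ?group1.
by rewrite dfung1_id /local_grp (negPf i_i0) eqxx.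
Qed.

Definition lift_base (f : X -> {perm Omega i0}) : overgroup :=
  ((finfun f, 1) : wreath X {perm Omega i0}, 1 : Ls).

Lemma lift_base_factor i f :
  (forall x, f x \in base_grp i x) -> lift_base f \in factor i.
Proof.
move=> fg; apply/factor_setP; split=> [|j|x] /=; first by rewrite twist1.
  by rewrite oneg_ffun group1.
by rewrite ffunE.
Qed.

Lemma lift_base_topE f x : wreath_top (lift_base f).1 x = x.
Proof. exact: perm1. Qed.

(** This makes evaluation of the base at [base ord0] multiplicative on [factor i0]. *)
Lemma factor_i0_fix g :
  g \in factor i0 -> wreath_top g.1 (base ord0) = base ord0.
Proof.
case/factor_setP=> -> lg _.
have [la lb] := (local_grp_fix a_i0 (lg a), local_grp_fix b_i0 (lg b)).
by rewrite twist_stab // pair_permE /= la lb.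
Qed.

(** * The amalgam: permutation type and order of the Borel subgroup *)

Definition factor_amalgam := subgroup_amalgam factor i0.

(** [factor i0] acts through the base coordinate at [base ord0], every other [factor i] through its
    component at [i]. In each case the Borel subgroup is the stabiliser of [w i]. *)
Lemma factor_perm_type i :
  perm_isomorphic (coset_perm_group (borel_in factor_amalgam i)) (L i).
Proof.
have [->|i_i0] := eqVneq i i0.
  apply: (@subgroup_amalgam_perm_type _ _ _ _ _ _ _
           (fun g : overgroup => wreath_base g.1 (base ord0)) (w i0)) => //.
  - by move=> g h Pg _; rewrite wreath_baseM factor_i0_fix.
  - apply/setP=> t; apply/imsetP/idP=> [[g /factor_setP[_ _ fg] ->]|Lt].
      by have := fg (base ord0); rewrite /base_grp !eqxx.
    exists (lift_base (fun x => if x == base ord0 then t else 1)).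
      apply: lift_base_factor => x; rewrite /base_grp eqxx.
      by case: (x == _); rewrite ?group1.
    by rewrite /= ffunE eqxx.
  move=> g Pg; have /factor_setP[Eg lg fg] := Pg.
  apply/borel_setP/idP=> [[_ _ Sg]|fw].
    by have := Sg (base ord0); rewrite mem_perm_stab => /andP[].
  split=> // [|x]; first by rewrite Eg twist_stab ?(local_grp_fix _ (lg _)).
  have := fg x; rewrite /base_grp eqxx; case: eqP => //= -> Lf.
  by rewrite mem_perm_stab Lf.
apply: (@subgroup_amalgam_perm_type _ _ _ _ _ _ _
         (fun g : overgroup => g.2 i) (w i)) => //.
- by move=> g h _ _; rewrite mulg_ffun.
- apply/setP=> t; apply/imsetP/idP=> [[g /factor_setP[_ lg _] ->]|Lt].
    by have := lg i; rewrite /local_grp (negPf i_i0) eqxx.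
  exists (lift_local t); first exact: lift_local_factor.
  by rewrite /= dfung1_id.
move=> g Pg; have /factor_setP[Eg lg fg] := Pg.
have Sf x : wreath_base g.1 x \in S i0.
  by have := fg x; rewrite /base_grp (negPf i_i0).
apply/borel_setP/idP=> [[_ Sg _]|fw].
  by rewrite (local_grp_fix i_i0 (Sg i)).
have lg0 j : g.2 j \in local_grp i0 j.
  have := lg j; rewrite /local_grp; case: (j == i0) => //.
  by case: eqP => // -> Lg; rewrite mem_perm_stab Lg.
by split=> //; rewrite Eg twist_stab ?(local_grp_fix _ (lg0 _)).
Qed.

Lemma borel_gt : S i0 :!=: 1 -> m < #|borel factor_amalgam|.
Proof.
case/trivgPn=> s Ss s1; rewrite card_borel_subgroup_amalgam.
(* Placing one [s != 1] at the base point of each copy already gives m + 1 elements. *)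
pose e (t : 'I_m.+1) := lift_base (fun x => if x == base t then s else 1).
have inj_e : injective e.
  move=> t u /(congr1 (fun g : overgroup => wreath_base g.1 (base t))) /=.
  rewrite !ffunE eqxx; case: eqP => [[-> //]|_ Es].
  by rewrite Es eqxx in s1.
have card_e: #|e @: [set: 'I_m.+1]| = m.+1.
  by rewrite card_imset // cardsT card_ord.
apply: leq_trans (eq_leq (esym card_e)) (subset_leq_card _).
apply/subsetP=> _ /imsetP[t _ ->]; apply/bigcapP=> i _.
apply: lift_base_factor => x; case: ifP => _; last exact: group1.
rewrite /base_grp; case: ifP => // _.
by move: Ss; rewrite mem_perm_stab => /andP[].
Qed.

(** * Faithfulness *)

Section Core.

Variable H : {group overgroup}.
Hypotheses (sHB : H \subset borel_set) (nHP : forall i, factor i \subset 'N(H)).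

(** In this form components can be compared without computing inverses in the wreath product. *)
Lemma core_conj i (h u : overgroup) :
  h \in H -> u \in factor i -> exists2 h', h' \in H & h * u = u * h'.
Proof.
move=> Hh Pu; exists (h ^ u); last exact: conjgC.
by rewrite memJ_norm // (subsetP (nHP i)).
Qed.

(** For [i != i0] the image of [H] in [L i] is normalised by [L i] and fixes [w i], so it lies in
    the core of a point stabiliser. *)
Lemma core_local (h : overgroup) i : h \in H -> h.2 i = 1.
Proof.
move=> Hh; have [->|i_i0] := eqVneq i i0.
  have /borel_setP[_ lh _] := subsetP sHB _ Hh.
  by have := lh i0; rewrite /local_grp eqxx => /set1P.
apply: (transitive_core1 (L_transitive i) (w := w i)) => t Lt.
have [h' Hh' E] := core_conj Hh (lift_local_factor i_i0 Lt).
exists (h'.2 i); last first.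
  have /borel_setP[_ lh' _] := subsetP sHB _ Hh'.
  exact: local_grp_fix (lh' i).
have /= := congr1 (fun g : overgroup => g.2 i) E.
by rewrite !mulg_ffun dfung1_id.
Qed.

Lemma core_top (h : overgroup) : h \in H -> wreath_top h.1 = 1.
Proof.
move=> Hh; have /borel_setP[-> _ _] := subsetP sHB _ Hh.
by rewrite !core_local // pair_perm1.
Qed.

Lemma core_topE (h : overgroup) x : h \in H -> wreath_top h.1 x = x.
Proof. by move=> Hh; rewrite core_top //; apply: perm1. Qed.

(** The core argument again, now for [L i0]: [h] and [u] have trivial permutation parts, so their
    coordinates multiply pointwise. *)
Lemma core_base0 (h : overgroup) : h \in H -> wreath_base h.1 (base ord0) = 1.
Proof.
move=> Hh; apply: (transitive_core1 (L_transitive i0) (w := w i0)) => t Lt.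
pose u := lift_base (fun x => if x == base ord0 then t else 1).
have Pu : u \in factor i0.
  apply: lift_base_factor => x; rewrite /base_grp eqxx.
  by case: (x == _); rewrite ?group1.
have [h' Hh' E] := core_conj Hh Pu.
exists (wreath_base h'.1 (base ord0)); last first.
  have /borel_setP[_ _ fh'] := subsetP sHB _ Hh'.
  by have := fh' (base ord0); rewrite mem_perm_stab => /andP[_ /eqP].
have: wreath_base (h * u).1 (base ord0) = wreath_base (u * h').1 (base ord0).
  by rewrite E.
rewrite !wreath_baseM core_topE // lift_base_topE.
by rewrite /wreath_base /= !ffunE eqxx.
Qed.

Definition vanishing (x : X) := forall h, h \in H -> wreath_base h.1 x = 1.

(** Conjugation by a lift with trivial base merely permutes the coordinates of elements of [H]. *)
Lemma vanishing_twist i t x : i != i0 -> t \in L i ->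
  vanishing (twist i (dfung1 t) x) -> vanishing x.
Proof.
move=> i_i0 Lt Vx h Hh.
have [h' Hh'] := core_conj Hh (lift_local_factor i_i0 Lt).
set u := lift_local t => E.
have: wreath_base (h * u).1 x = wreath_base (u * h').1 x by rewrite E.
rewrite !wreath_baseM core_topE // /wreath_base /= !ffunE mulg1 mul1g => ->.
exact: Vx.
Qed.

Lemma vanishing_a x x' y t : vanishing (x', y, t) -> vanishing (x, y, t).
Proof.
have [s Ls <-] := transitive_groupP (L_transitive a) x x' => V.
apply: (vanishing_twist a_i0 Ls).
by rewrite /twist eq_sym (negPf b_a) conjg1 pair_permE dfung1_id
  dfung1_dflt ?perm1 // eq_sym.
Qed.

(** The action of [L b] is conjugated by [shift], so it changes the second coordinate of the
    preimage under [shift]. *)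
Lemma vanishing_b x y y' t :
  vanishing (shift (x, y', t)) -> vanishing (shift (x, y, t)).
Proof.
have [s Ls <-] := transitive_groupP (L_transitive b) y y' => V.
apply: (vanishing_twist b_i0 Ls).
by rewrite /twist eqxx permJ pair_permE dfung1_id dfung1_dflt // perm1.
Qed.

Lemma vanishing_all x : vanishing x.
Proof.
(* Points with a coordinate [x'] or [y'] are not base points, so [shift] fixes them. *)
have [x' ax'] := nontrivial_transitive_neq (w a) (L_nontrivial a).
have [y' by'] := nontrivial_transitive_neq (w b) (L_nontrivial b).
have shift_x' y t : shift (x', y, t) = (x', y, t).
  by rewrite shift_id // xpair_eqE (negPf ax').
have shift_y' z t : shift (z, y', t) = (z, y', t).
  by rewrite shift_id // xpair_eqE (negPf by') andbF.
have Vx' y t : vanishing (base t) -> vanishing (x', y, t).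
  move=> V; rewrite -shift_x'; apply: (@vanishing_b _ _ (w b)).
  by rewrite shift_x'; apply: vanishing_a V.
(* Induction along the copies, starting from [core_base0]; the bound on [n] keeps [ordS] from
   wrapping around. *)
have Vbase n : n <= m -> vanishing (base (inord n)).
  elim: n => [_|n IHn lt_n_m].
    by rewrite (_ : inord 0 = ord0) //; [apply: core_base0 |
       apply: val_inj; rewrite /= inordK].
  have -> : inord n.+1 = ordS (inord n) :> 'I_m.+1.
    by apply: val_inj; rewrite /= !inordK ?modn_small // ltnW.
  (* The point [(w a, y', inord n)] is reached within copy [n] and fixed by [shift]. The twisted
     action of [L b] takes it to the shifted base point, which is that of the next copy. *)
  rewrite -shift_base; apply: (@vanishing_b _ _ y'); rewrite shift_y'.
  exact: vanishing_a (Vx' y' _ (IHn (ltnW lt_n_m))).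
case: x => [[x y] t]; apply: vanishing_a (Vx' y t _).
by rewrite -(inord_val t); apply: Vbase; rewrite -ltnS.
Qed.

Lemma factor_core1 : H :=: 1.
Proof.
apply/trivgP/subsetP=> -[[f p] l] Hh; apply/set1P.
congr (_, _); first congr (_, _).
- by apply/ffunP=> x; rewrite ffunE; apply: (vanishing_all x Hh).
- exact: (core_top Hh).
by apply/ffunP=> i; rewrite ffunE; apply: (core_local i Hh).
Qed.

End Core.

Lemma factor_amalgam_faithful : faithful_amalgam factor_amalgam.
Proof. by apply: faithful_subgroup_amalgam => H; apply: factor_core1. Qed.

End Construction.

(** * The equivalence *)

Theorem theorem1p4 (k : nat) (hk : (3 <= k)%N)
    (Omega : 'I_k -> finType) (L : forall i : 'I_k, {group {perm Omega i}})
    (L_nontrivial : forall i : 'I_k, L i :!=: 1%g)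
    (L_transitive : forall i : 'I_k, transitive_group (L i)) :
  (exists i : 'I_k, ~ regular_group (L i)) <->
  (forall c : int, exists A : amalgam k,
     [/\ faithful_amalgam A,
         has_permutation_type A L
       & (c <= Posz #|borel A|)%R]).
Proof.
split=> [[i0 nreg] c|bigA].
  have exw i : exists _ : Omega i, true.
    have /trivgPn[s _] := L_nontrivial i.
    have [x _ _|noT] := pickP (Omega i); first by exists x.
    by case/eqP; apply/permP=> x; have := noT x.
  have [w _] := fin_all_exists exw.
  (* Here k >= 3 is used: it provides two distinct indices other than [i0]. *)
  have /card_gt1P[a [b []]] : 1 < #|[set~ i0]|.
    by rewrite cardsC1 card_ord -ltnS prednK // (leq_trans _ hk).
  rewrite !inE => a_i0 b_i0; rewrite eq_sym => b_a.
  pose A := factor_amalgam L w `|c|%N a_i0 b_i0.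
  exists A; split.
  - exact: factor_amalgam_faithful.
  - by exists 1 => i; rewrite perm1; apply: factor_perm_type.
  apply: Order.POrderTheory.le_trans (lez_abs c) _; rewrite lez_nat ltnW //.
  by apply: borel_gt; apply: nonregular_stab (L_transitive i0) _ nreg.
(* Transitivity being given, regularity amounts to a decidable statement about stabilisers, so no
   classical axiom is involved. *)
have [/existsP[i nreg]|reg] :=
    boolP [exists i, ~~ [forall x, 'C_(L i)[x | 'P] == 1]].
  exists i => -[_ reg]; case/negP: nreg.
  by apply/forallP=> x; apply/eqP.
have {}reg i : regular_group (L i).
  split=> // x; apply/eqP; move: x; apply/forallP.
  by move: reg; rewrite negb_exists => /forallP/(_ i); rewrite negbK.
(* The bound 2 suffices: if all groups are regular, the Borel subgroup is normal in every P_i, and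
   faithfulness makes its order 1. *)
have [A [faithA [s typeA] cA]] := bigA (Posz 2).
have: #|borel A| = 1%N.
  apply: faithA => // i; first exact: borel_in_group_set.
  by case/andP: (coset_perm_group_regular (reg _) (typeA i)).
by move: cA => /[swap] ->.
Qed.
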